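(* Let $K$ be a field of any characteristic, let $X=\{x_1,x_2,\ldots\}$ be a countably infinite set ordered by $x_1<x_2<\cdots$, and let $S$ be the semigroup consisting of all endomorphisms of the free unitary associative algebra $K\langle X\rangle$ which send $X$ to $X$ and preserve the ordering on $X$. Then the set of polynomials \[ [[x_2,x_1],x_1],\quad [x_2,[x_2,x_1]],\quad [x_3,[x_2,x_1]],\quad [[x_3,x_1],x_2],\quad [[x_3,x_2],[x_3,x_1]] \] is a Gröbner $S$-basis, with respect to the deg-lex ordering, of the two-sided ideal of $K\langle X\rangle$ generated by $\gamma_3(L)$.
   Context: $K\langle X\rangle$ is the free unitary associative $K$-algebra on $X$; $\langle X\rangle$ is its set of words (monomials). $[f,g]=fg-gf$. $L=L(X)$ is the Lie subalgebra of $K\langle X\rangle$ generated by $X$ under the commutator (the free Lie algebra on $X$), and $\gamma_3(L)=[L,L,L]=[[L,L],L]$ is the third member of its lower central series. An endomorphism $\varphi$ sending $X$ to $X$ (that is, $\varphi(X)\subseteq X$) preserves the ordering on $X$ if $x_i<x_j$ implies $\varphi(x_i)<\varphi(x_j)$. Deg-lex ordering on $\langle X\rangle$: monomials are compared first by total degree and then lexicographically, reading from left to right, with $x_1<x_2<\cdots$. For nonzero $f\in K\langle X\rangle$, $\mathrm{lt}(f)$ is the greatest monomial occurring in $f$ (with nonzero coefficient). A subset $G$ of a two-sided ideal $I$ is a Gröbner basis of $I$ if for every nonzero $f\in I$ there is a (nonzero) $g\in G$ such that $\mathrm{lt}(g)$ is a subword (contiguous factor) of $\mathrm{lt}(f)$.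 For a semigroup $S$ of $K$-algebra endomorphisms of $K\langle X\rangle$ containing the identity, an $S$-ideal is a two-sided ideal $I$ with $\varphi(I)\subset I$ for all $\varphi\in S$. A subset $G\subset I$ of an $S$-ideal $I$ is a Gröbner $S$-basis of $I$ if $S(G)=\{\varphi(g)\mid\varphi\in S,\ g\in G\}$ is a Gröbner basis of $I$ as a two-sided ideal. *)

(* Defs.v *)
From HB Require Import structures.
From mathcomp Require Import all_boot all_order ssralg.
From mathcomp Require Import finmap monalg.

Set Implicit Arguments.
Unset Strict Implicit.
Unset Printing Implicit Defensive.

Import Order.TTheory GRing.Theory.
Local Open Scope ring_scope.

(* The free algebra is the monoid algebra of the free monoid {fmonom nat};
   the letter i : nat stands for x_(i+1). *)
Notation word := {fmonom nat}.
Notation "{ 'freeAlg' K }" := {malg K[word]} (format "{ 'freeAlg'  K }") :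
  type_scope.

Definition letter (K : fieldType) (i : nat) : {freeAlg K} := << fmu i >>.

Definition bracket (R : nzRingType) (f g : R) : R := f * g - g * f.
Notation "[< f , g >]" := (bracket f g) (format "[<  f ,  g  >]") : ring_scope.

(* Degree first, then left-to-right lexicographic comparison of the words. *)
Definition deglex_key (w : word) : (nat *l seqlexi nat)%type :=
  (fdeg w, w : seq nat).
Definition deglex (u v : word) : bool := (deglex_key u <= deglex_key v)%O.

Definition deglex_max (u v : word) : word := if deglex u v then v else u.

(* Junk value 1 (the empty word) at f = 0. *)
Definition lead_word (K : fieldType) (f : {freeAlg K}) : word :=
  \big[deglex_max/fmone _]_(m <- msupp f) m.

Section Sets.
Variable K : fieldType.
Notation A := {freeAlg K}.
Implicit Types (P U V I G : A -> Prop) (f g h : A).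

Definition subset_of P U := forall f, P f -> U f.

Definition subspace U :=
  [/\ U 0, forall f g, U f -> U g -> U (f + g) & forall a f, U f -> U (a *: f)].

Definition span P f := forall U, subspace U -> subset_of P U -> U f.

Definition lie_subalgebra U :=
  subspace U /\ (forall f g, U f -> U g -> U [< f, g >]).

Definition lie_gen P f := forall U, lie_subalgebra U -> subset_of P U -> U f.

Definition lie_prod U V : A -> Prop :=
  span (fun h => exists f g, [/\ U f, V g & h = [< f, g >]]).

Definition two_sided_ideal I :=
  [/\ I 0, forall f g, I f -> I g -> I (f + g),
      forall f g, I g -> I (f * g) & forall f g, I f -> I (f * g)].

Definition ideal_gen P f := forall I, two_sided_ideal I -> subset_of P I -> I f.

Definition free_lie : A -> Prop := lie_gen (fun f => exists i, f = letter K i).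
Definition gamma3 : A -> Prop := lie_prod (lie_prod free_lie free_lie) free_lie.

Definition groebner_basis I G :=
  subset_of G I /\
  forall f, I f -> f != 0 ->
    exists g, [/\ G g, g != 0 & infix (lead_word g) (lead_word f)].

Record endo_semigroup := EndoSemigroup {
  in_endos :> {lrmorphism A -> A} -> Prop;
  endos_id : in_endos (idfun : {lrmorphism A -> A});
  endos_comp : forall phi psi : {lrmorphism A -> A},
    in_endos phi -> in_endos psi ->
    in_endos ((phi \o psi : A -> A) : {lrmorphism A -> A}) }.

Definition S_ideal (S : endo_semigroup) I :=
  two_sided_ideal I /\
  forall phi : {lrmorphism A -> A}, S phi -> forall f, I f -> I (phi f).

Definition S_image (S : endo_semigroup) G h :=
  exists phi : {lrmorphism A -> A}, exists g, [/\ S phi, G g & h = phi g].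

Definition groebner_S_basis (S : endo_semigroup) I G :=
  [/\ S_ideal S I, subset_of G I & groebner_basis I (S_image S G)].

Definition monotone_endo (phi : {lrmorphism A -> A}) :=
  (forall i, exists j, phi (letter K i) = letter K j) /\
  (forall i j k l, (i < j)%N ->
     phi (letter K i) = letter K k -> phi (letter K j) = letter K l ->
     (k < l)%N).

End Sets.

Lemma letter_inj (K : fieldType) : injective (letter K).
Proof.
move=> i j /(congr1 (mcoeff (fmu i))); rewrite !mcoeffU1 eqxx.
case: eqP => [/(congr1 (@fmonom_val nat))|_ /eqP]; last by rewrite oner_eq0.
by rewrite !fmuE /= => -[].
Qed.

Lemma monotone_endo_id (K : fieldType) :
  monotone_endo (idfun : {lrmorphism {freeAlg K} -> {freeAlg K}}).
Proof.
split=> [i|i j k l lt_ij]; first by exists i.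
by move=> /letter_inj <- /letter_inj <-.
Qed.

Lemma monotone_endo_comp (K : fieldType)
    (phi psi : {lrmorphism {freeAlg K} -> {freeAlg K}}) :
  monotone_endo phi -> monotone_endo psi ->
  monotone_endo ((phi \o psi : {freeAlg K} -> {freeAlg K})
                   : {lrmorphism {freeAlg K} -> {freeAlg K}}).
Proof.
move=> [phiX phi_lt] [psiX psi_lt]; split=> [i|i j k l lt_ij] /=.
  by have [j ->] := psiX i; apply: phiX.
have [i' psi_i] := psiX i; have [j' psi_j] := psiX j.
by rewrite psi_i psi_j; apply: phi_lt; apply: psi_lt lt_ij psi_i psi_j.
Qed.

Definition monotone_endos (K : fieldType) : endo_semigroup K :=
  EndoSemigroup (monotone_endo_id K) (@monotone_endo_comp K).

Lemma lead_word_greatest (K : fieldType) (f : {freeAlg K}) (m : word) :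
  m \in msupp f -> deglex m (lead_word f).
Proof.
rewrite /lead_word -[m \in _]/(m \in enum_fset (msupp f)).
elim: (enum_fset _) => // w s IHs; rewrite big_cons inE.
rewrite /deglex_max; set b := \big[_/_]_(_ <- _) _ in IHs *.
case/predU1P=> [->|/IHs le_mb]; case: ifP => // /negbT.
  by move=> _; rewrite /deglex.
by rewrite -ltNge => /ltW; apply: le_trans.
Qed.

Lemma lead_word_msupp (K : fieldType) (f : {freeAlg K}) : f != 0 ->
  lead_word f \in msupp f.
Proof.
rewrite -msupp_eq0 => /fset0Pn[m].
rewrite /lead_word -[m \in _]/(m \in enum_fset (msupp f)).
rewrite -[(\big[_/_]_(_ <- _) _) \in _]/(_ \in enum_fset (msupp f)).
elim: (enum_fset _) m => // w s IHs m _.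
rewrite big_cons /deglex_max; case: ifP => [|_]; last by rewrite mem_head.
case: s IHs => [_|w' s IHs _]; last first.
  by rewrite in_cons (IHs w') ?orbT // mem_head.
rewrite big_nil inE => le_w1; suff -> : w = fmone _ by [].
apply/fdeg_eq0I/eqP; rewrite -leqn0 -(@fdeg1 nat).
by move: le_w1; rewrite /deglex /Order.le /= => /andP[].
Qed.

(* Main.v *)
From HB Require Import structures.
Require Import Defs.
From mathcomp Require Import all_boot all_order ssralg.
From mathcomp Require Import finmap monalg.
From mathcomp Require mpoly.
From mathcomp Require Import zify ring.
Import Order.TTheory GRing.Theory.
Local Open Scope ring_scope.

Set Implicit Arguments.
Unset Strict Implicit.
Unset Printing Implicit Defensive.

(** Why the theorem is true.  Modulo the ideal I generated by gamma_3(L), the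
    free algebra becomes the enveloping algebra of the free nilpotent Lie
    algebra of class 2: the commutators [x_a, x_b] with a > b are central.  By
    Poincare-Birkhoff-Witt its basis is indexed by the multisets of letters and
    of pairs a > b.  The five polynomials and their images under order
    preserving relabellings have as leading words the shapes

      j i i,  j j i,  k j i,  k i j,  k j k i      (i < j < k),

    and a word avoiding all of them is a concatenation of items, namely
    letters a and descents a b (a > b), in weakly increasing order of (a, a),
    respectively (a, b), for the lexicographic order on pairs
    ([normal_or_obstructed]).  So the words that avoid the leading words are in
    bijection with the expected basis, and what remains is to see that they
    are linearly independent modulo I.

    Suppose then that f in I is nonzero with a normal leading word w.  Reducing
    the other words of f ([normal_form], a well-founded induction on words)
    turns f into an element of I which still contains w and all of whose words
    are normal.  Such an element vanishes ([normal_combination_eq0]), a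
    contradiction.

    For the vanishing, the free algebra acts on the right on the polynomial
    ring in commuting variables t_i and z_ab (a > b), the letter x_i acting as
    t_i + sum over j > i of z_ji d/dt_j.  The commutator of two letters acts as
    multiplication by some +-z_ab or 0, so it commutes with every letter, and I
    acts by zero ([gamma3_in_ideal], [killed_gamma3]).  Give z_ab the weight a
    and t_i the weight 0.  The normal word with items s sends 1 to the product
    of the variables attached to s, with coefficient 1, plus terms of smaller
    weight ([act_spell]); the product determines s, so a linear combination of
    normal words killing 1 is zero ([act_independent]).  The coefficient 1 is
    what makes the argument work in every characteristic. *)

(** * Normal words and obstructions *)

(** An item (a, b) with b < a stands for the descent a b and for the central
    commutator [x_a, x_b]; the item (a, a) stands for the single letter a.
    With this encoding the letter a comes after all descents that start with
    a, as it does in a normal word. *)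
Definition item_le (p q : nat * nat) : bool :=
  (p.1 < q.1)%N || ((p.1 == q.1) && (p.2 <= q.2)%N).

Definition item_word (p : nat * nat) : seq nat :=
  if (p.2 < p.1)%N then [:: p.1; p.2] else [:: p.1].

Definition spell (s : seq (nat * nat)) : seq nat := flatten (map item_word s).

(** Reading a word from right to left, a new letter a that is larger than the
    first letter c of the rest can only be the start of a descent a c, which
    requires c to be an item by itself.  When c is itself the start of a
    descent c d, the result forgets d: it no longer spells the word, and the
    test in [normal] fails, as it should for the obstruction a c d. *)
Definition push_letter (a : nat) (s : seq (nat * nat)) : seq (nat * nat) :=
  if s is (c, _) :: s' then if (c < a)%N then (a, c) :: s' else (a, a) :: s
  else [:: (a, a)].

Definition items : seq nat -> seq (nat * nat) := foldr push_letter [::].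

Definition normal (w : seq nat) : bool :=
  [&& spell (items w) == w, sorted item_le (items w)
    & all (fun p => p.2 <= p.1)%N (items w)].

(** The leading words of the five generators, with 0, 1, 2 for x1, x2, x3. *)
Definition obstructions : seq (seq nat) :=
  [:: [:: 1; 0; 0]; [:: 1; 1; 0]; [:: 2; 1; 0]; [:: 2; 0; 1];
      [:: 2; 1; 2; 0]]%N.

Lemma item_le_trans : transitive item_le.
Proof. move=> [a b] [c d] [e f]; rewrite /item_le /=; lia. Qed.

Lemma item_le_anti : antisymmetric item_le.
Proof.
move=> [a b] [c d]; rewrite /item_le /= => h.
by congr (_, _); lia.
Qed.

(** Endomorphisms preserving the order must be increasing on all letters, so
    the pattern i < j < k has to be extended past the letters it mentions. *)
Lemma increasing_extension (i j k : nat) : (i < j < k)%N ->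
  exists h : nat -> nat,
    [/\ {homo h : a b / (a < b)%N}, h 0%N = i, h 1%N = j & h 2%N = k].
Proof.
move=> ijk; exists (fun m => if m is m'.+2 then (k + m')%N else
  if m is 1 then j else i); split; rewrite /= ?addn0 //.
move=> [|[|a]] [|[|b]] //=; lia.
Qed.

(** Prefix a letter a to a normal word with first item (c, d).  If a < c, or if
    a = c = d, then a is a new item.  If a > c = d, then a c is a new descent,
    in the right place unless the next item is smaller than (a, c), which is
    one of the patterns j i i, k i j and k j k i.  If c d is a descent and
    a >= c, the word starts with a pattern k j i or j j i. *)
Lemma normal_or_obstructed (w : seq nat) :
  normal w \/ exists h : nat -> nat, exists2 p,
    {homo h : a b / (a < b)%N} & (p \in obstructions) && infix (map h p) w.
Proof.
elim: w => [|a w [nw|[h [p hh /andP[pO iw]]]]]; first by left.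
- have obs : (exists i j k p, [/\ (i < j < k)%N, p \in obstructions &
      forall h : nat -> nat, h 0%N = i -> h 1%N = j -> h 2%N = k ->
      prefix (map h p) (a :: w)]) ->
    exists h : nat -> nat, exists2 p, {homo h : a b / (a < b)%N} &
      (p \in obstructions) && infix (map h p) (a :: w).
    move=> [i [j [k [p [ijk pO pw]]]]].
    have [h [hh hi hj hk]] := increasing_extension ijk.
    by exists h, p => //; rewrite pO prefixW // pw.
  have /and3P[/eqP sw srt ok] := nw.
  rewrite /normal -[items (a :: w)]/(push_letter a (items w)).
  case: (items w) sw srt ok => [|[c d] s] sw.
    move: sw; rewrite /spell /= => <- _ _; left.
    by rewrite /item_word /= ltnn leqnn eqxx.
  move=> srt /andP[/= dc ok0]; rewrite /push_letter.
  have {ok0} ok : all (fun p => p.2 <= p.1)%N s by exact: ok0.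
  case: ltnP => ac; last first.
    have [ac'|] := ltnP a c.
      left; apply/and3P; split; last by rewrite /= leqnn dc ok.
        by rewrite -sw /spell /= {1}/item_word /= ltnn.
      by rewrite /= /item_le /= ac'.
    move=> ca; have eca : a = c by lia.
    subst a => {ca ac}.
    case: (ltnP d c) => [ltdc|]; last first.
      move=> cd; have {cd dc} edc : d = c by lia.
      left; rewrite edc in sw srt *; apply/and3P; split.
      - by rewrite -sw /spell /= /item_word /= ltnn.
      - by rewrite /= /item_le /= eqxx leqnn orbT.
      - by rewrite /= leqnn ok.
    (* The pattern j j i has no third letter; c.+1 only fills its place. *)
    right; apply: obs; exists d, c, c.+1, [:: 1; 1; 0]%N.
    split=> //; first lia.
    move=> h h0 h1 _; rewrite -sw /spell /= /item_word ltdc /= h1 h0.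
    by rewrite !eqxx prefix0s.
  case: (ltnP d c) => [ltdc|cd].
    right; apply: obs; exists d, c, a, [:: 2; 1; 0]%N; split => //; first lia.
    move=> h h0 h1 h2; rewrite -sw /spell /= /item_word ltdc /= h2 h1 h0.
    by rewrite !eqxx prefix0s.
  have {cd dc} edc : d = c by lia.
  subst d.
  have sw' : w = c :: spell s by rewrite -sw /spell /= /item_word ltnn.
  have good : path item_le (a, c) s -> [&& spell ((a, c) :: s) == a :: w,
      path item_le (a, c) s & all (fun p => p.2 <= p.1)%N ((a, c) :: s)].
    by move=> ->; rewrite /= ok (ltnW ac) sw' /spell /= /item_word /= ac !eqxx.
  case: s => [|[e f] s] in srt ok sw sw' good *; first by left; apply: good.
  move: srt => /= /andP[ce srt].
  have ce' : (c <= e)%N by move: ce; rewrite /item_le /=; lia.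
  have hd : exists r, w = [:: c, e & r].
    rewrite sw' /spell /= /item_word /=.
    by case: ifP => _ /=; eexists.
  have [r wr] := hd.
  have [ae|ea|eae] := ltngtP a e.
  + by left; apply: good; rewrite /= srt andbT /item_le /= ae.
  + right; apply: obs; have [lce|] := ltnP c e.
      exists c, e, a, [:: 2; 0; 1]%N; split => //; first lia.
      by move=> h h0 h1 h2; rewrite wr /= h0 h1 h2 !eqxx prefix0s.
    move=> ec; exists c, a, a.+1, [:: 1; 0; 0]%N; split => //; first lia.
    have {ec} ec : e = c by lia.
    by move=> h h0 h1 h2; rewrite wr /= h0 h1 ec !eqxx prefix0s.
  + subst e; have [cf|fc] := leqP c f.
      by left; apply: good; rewrite /= srt andbT /item_le /= eqxx cf orbT.
    right; apply: obs; exists f, c, a, [:: 2; 1; 2; 0]%N.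
    split=> //; first lia.
    move=> h h0 h1 h2; rewrite sw' /spell /= /item_word.
    by rewrite (ltn_trans fc ac) /= h0 h1 h2 !eqxx prefix0s.
- by right; exists h, p => //; rewrite pO /= iw orbT.
Qed.

(** * The word order used for reduction *)

Fixpoint lex_lt (u v : seq nat) : bool :=
  match u, v with
  | a :: u', b :: v' => (a < b)%N || ((a == b) && lex_lt u' v')
  | _, _ => false
  end.

(** Reductions preserve the length of a word, so tails of the generators are
    compared among words of equal length.  Unlike deglex itself, this relation
    is computed by evaluation on explicit words, and it is visibly preserved by
    increasing relabellings and by multiplication on both sides. *)
Definition below (v u : seq nat) : bool := (size u == size v) && lex_lt u v.

Lemma lex_lt_trans : transitive lex_lt.
Proof.
elim=> [|b v IHv] [|a u] [|c w] //= /orP[ab|/andP[/eqP -> uv]].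
  case/orP => [bc|/andP[/eqP <- _]]; last by rewrite ab.
  by rewrite (ltn_trans ab bc).
by case/orP => [-> //|/andP[-> /(IHv _ _ uv) ->]]; rewrite orbT.
Qed.

Lemma below_trans (w v u : seq nat) : below w v -> below v u -> below w u.
Proof.
move=> /andP[/eqP vw lvw] /andP[/eqP uv luv].
by rewrite /below uv vw eqxx (lex_lt_trans luv lvw).
Qed.

Lemma below_map (h : nat -> nat) (v u : seq nat) :
  {homo h : a b / (a < b)%N} -> below v u -> below (map h v) (map h u).
Proof.
move=> hh /andP[/eqP uv luv]; rewrite /below !size_map uv eqxx /=.
elim: u v luv {uv} => [|a u IHu] [|b v] //= /orP[/hh -> //|].
move=> /andP[/eqP-> /IHu ->].
by rewrite eqxx orbT.
Qed.

Lemma below_cat (x y v u : seq nat) :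
  below v u -> below (x ++ v ++ y) (x ++ u ++ y).
Proof.
move=> /andP[/eqP uv luv]; rewrite /below !size_cat uv eqxx /=.
have {luv} luv : lex_lt (u ++ y) (v ++ y).
  elim: u v luv {uv} => [|a u IHu] [|b v] //= /orP[-> //|/andP[-> /IHu ->]].
  by rewrite orbT.
by elim: x => //= a x ->; rewrite eqxx orbT.
Qed.

Lemma below_deglex (v u : word) : below v u -> deglex u v && (u != v).
Proof.
move=> /andP[/eqP uv luv]; apply/andP; split; last first.
  apply/negP => /eqP euv; move: luv; rewrite euv.
  by elim: (v : seq nat) => //= a s IHs; rewrite ltnn eqxx.
rewrite /deglex /deglex_key !fdegE uv lexi_pair lexx /=.
elim: (u : seq nat) (v : seq nat) luv {uv} => [|a s IHs] [|b t] //= /orP[ab|].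
  rewrite lexi_cons leEnat (ltnW ab) /=; apply/implyP; lia.
by move=> /andP[/eqP -> /IHs st]; rewrite lexi_cons lexx.
Qed.

Lemma deglex_anti : antisymmetric deglex.
Proof. by move=> u v; rewrite /deglex -eq_le => /eqP[_ /val_inj]. Qed.

(** Words of a fixed length are well-founded for the lexicographic order, even
    over infinitely many letters: induct on the length, then on the first
    letter, then on the rest of the word. *)
Lemma below_ind (P : seq nat -> Prop) :
  (forall w, (forall v, below w v -> P v) -> P w) -> forall w, P w.
Proof.
move=> IH w; move: {2}(size w) (erefl (size w)) => n.
elim: n P IH w => [|n IHn] P IH w.
  by move=> /size0nil ->; apply: IH => -[].
case: w => // a w [sw].
elim/ltn_ind: a w sw => a IHa w sw.
apply: (IHn (fun w => size w = n -> P (a :: w))) => // {sw} {}w IHw sw.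
apply: IH => -[|b v] //= /andP[/eqP /= [sv]] /= /orP[ba|/andP[/eqP -> vw]].
  by apply: IHa => //; rewrite sv.
by apply: IHw; rewrite ?sv // /below sv eqxx.
Qed.

(** * Brackets in the free algebra *)

Section Bracket.
Variable R : nzRingType.
Implicit Types f g h : R.

Lemma bracketC f g : [< f, g >] = - [< g, f >].
Proof. by rewrite /bracket opprB. Qed.

Lemma bracket0 f : [< f, 0 >] = 0.
Proof. by rewrite /bracket mulr0 mul0r subrr. Qed.

Lemma bracket1 f : [< f, 1 >] = 0.
Proof. by rewrite /bracket mulr1 mul1r subrr. Qed.

Lemma bracketDr f g h : [< f, g + h >] = [< f, g >] + [< f, h >].
Proof. by rewrite /bracket mulrDr mulrDl opprD addrACA. Qed.

Lemma bracketDl f g h : [< f + g, h >] = [< f, h >] + [< g, h >].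
Proof. by rewrite /bracket mulrDr mulrDl opprD addrACA. Qed.

Lemma bracket0l f : [< 0, f >] = 0.
Proof. by rewrite /bracket mulr0 mul0r subrr. Qed.

Lemma bracketMr f g h : [< f, g * h >] = [< f, g >] * h + g * [< f, h >].
Proof. by rewrite /bracket mulrBl mulrBr !mulrA addrA subrK. Qed.

Lemma bracket_jacobi f g h :
  [< [< f, g >], h >] = [< f, [< g, h >] >] - [< g, [< f, h >] >].
Proof.
rewrite /bracket !mulrBl !mulrBr !mulrA !opprB.
set a := f * g * h; set b := g * f * h; set c := h * g * f; set d := h * f * g.
set x := f * h * g; set y := g * h * f.
by rewrite [RHS]addrACA !subrKA [RHS]addrACA [- d - b]addrC -addrACA.
Qed.

End Bracket.

Section FreeAlgebra.
Variable K : fieldType.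
Local Notation A := {freeAlg K}.
Implicit Types (f g h : A) (I U : A -> Prop) (m : word).

Fact wmon_key : unit. Proof. by []. Qed.
(** Locked, since otherwise unification unfolds the algebra operations when it
    compares a word with a product or with a linear combination. *)
Definition wmon (s : seq nat) : A := locked_with wmon_key << FMonom s >>.

Lemma wmonE s : wmon s = << FMonom s >>.
Proof. exact: unlock. Qed.

Lemma word_eta m : FMonom m = m.
Proof. by case: m. Qed.

Lemma mulUU (c d : K) m1 m2 :
  << c *g m1 >> * << d *g m2 >> = << c * d *g mmul m1 m2 >> :> A.
Proof. exact: fgmulUU. Qed.

Lemma mmulE m1 m2 : mmul m1 m2 = FMonom (m1 ++ m2).
Proof. by apply/val_inj; rewrite /= fmM. Qed.

Lemma wmonM s t : wmon s * wmon t = wmon (s ++ t).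
Proof. by rewrite !wmonE mulUU mulr1 mmulE. Qed.

Lemma letterE i : letter K i = wmon [:: i].
Proof. by rewrite /letter fmuE wmonE. Qed.

Lemma wmon0 : wmon [::] = 1.
Proof. by rewrite wmonE; congr << _ >>; apply/val_inj; rewrite /= fm1. Qed.

Lemma wmonZ (c : K) s : c *: wmon s = << c *g FMonom s >>.
Proof. by rewrite wmonE -mul_malgC mulUU mulr1 mul1m. Qed.

Lemma freeAlg_ind U : U 0 -> (forall f g, U f -> U g -> U (f + g)) ->
  (forall (c : K) s, U (c *: wmon s)) -> forall f, U f.
Proof.
move=> U0 UD UZ f; rewrite (monalgE f); elim/big_ind: _ => // m _.
by rewrite -[m in << _ *g m >>]word_eta -wmonZ.
Qed.

(** Scalars are central because the empty word is neutral on both sides; this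
    makes multiplication bilinear although words do not commute. *)
Lemma malgC_comm (c : K) f : f * c%:MP = c%:MP * f.
Proof.
elim/freeAlg_ind: f => [|f g IHf IHg|d s]; first by rewrite mul0r mulr0.
  by rewrite mulrDl mulrDr IHf IHg.
by rewrite wmonZ (mulUU d c) (mulUU c d) (mulrC d c) mulm1 mul1m.
Qed.

Lemma mulrZ (c : K) f g : f * (c *: g) = c *: (f * g).
Proof. by rewrite -!mul_malgC mulrA malgC_comm mulrA. Qed.

Lemma bracketZr (c : K) f g : [< f, c *: g >] = c *: [< f, g >].
Proof. by rewrite /bracket mulrZ -scalerAl -scalerBr. Qed.

Lemma bracketZl (c : K) f g : [< c *: f, g >] = c *: [< f, g >].
Proof. by rewrite bracketC bracketZr -scalerN -bracketC. Qed.

(** * Ideals containing gamma_3 *)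

Section Ideal.
Variable I : A -> Prop.
Hypothesis idealI : two_sided_ideal I.

Lemma ideal0 : I 0. Proof. by case: idealI. Qed.
Lemma idealD f g : I f -> I g -> I (f + g).
Proof. by case: idealI => _ + _ _; apply. Qed.
Lemma idealMl f g : I g -> I (f * g).
Proof. by case: idealI => _ _ + _; apply. Qed.
Lemma idealMr f g : I f -> I (f * g).
Proof. by case: idealI => _ _ _; apply. Qed.
Lemma idealN f : I f -> I (- f).
Proof. by rewrite -mulN1r; apply: idealMl. Qed.
Lemma idealB f g : I f -> I g -> I (f - g).
Proof. by move=> If Ig; apply/idealD/idealN. Qed.
Lemma idealZ (c : K) f : I f -> I (c *: f).
Proof. by rewrite -mul_malgC; apply: idealMl. Qed.

Lemma ideal_bracket f g : I f -> I [< f, g >].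
Proof. by move=> If; apply: idealB; [apply: idealMr|apply: idealMl]. Qed.

(** Modulo I the brackets of two letters are central.  Let C be the centralizer
    of the letters modulo I; by the Leibniz rule it centralizes everything.  The
    elements f with [f, x_i] in C for all i form a Lie subalgebra, because by
    the Jacobi identity the bracket of two of them is in C; it contains the
    letters, hence L.  So [L, L] lies in C, and [[L, L], L] in I. *)
Lemma gamma3_in_ideal :
  (forall i j k, I [< [< letter K i, letter K j >], letter K k >]) ->
  subset_of (@gamma3 K) I.
Proof.
move=> Ixxx; pose C h := forall k, I [< h, letter K k >].
have C_central h : C h -> forall f, I [< h, f >].
  move=> Ch; apply: freeAlg_ind => [|f g If Ig|c s].
  - by rewrite bracket0; apply: ideal0.
  - by rewrite bracketDr; apply: idealD.
  rewrite bracketZr; apply: idealZ; elim: s => [|a s IHs].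
    by rewrite wmon0 bracket1; apply: ideal0.
  have -> : wmon (a :: s) = letter K a * wmon s by rewrite letterE wmonM.
  rewrite bracketMr; exact: (idealD (idealMr _ (Ch a)) (idealMl _ IHs)).
have C_subspace : subspace C.
  split=> [k|f g Cf Cg k|a f Cf k].
  - by rewrite bracket0l; exact: ideal0.
  - by rewrite bracketDl; exact: (idealD (Cf k) (Cg k)).
  by rewrite bracketZl; exact: (idealZ _ (Cf k)).
have C_bracket f g : (forall i, C [< f, letter K i >]) ->
    (forall i, C [< g, letter K i >]) -> C [< f, g >].
  move=> Cf Cg k; rewrite bracket_jacobi.
  by apply: idealB; rewrite bracketC; apply/idealN/C_central.
pose N f := forall i, C [< f, letter K i >].
have lieC f : free_lie f -> N f.
  move/(_ N); apply; last by move=> _ [i ->] j k; apply: Ixxx.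
  have [C0 CD CZ] := C_subspace.
  split=> [|f1 g1 Cf Cg i]; last first.
    by move=> k; apply: ideal_bracket; exact: (C_bracket _ _ Cf Cg i).
  split=> [i|f1 g1 Cf Cg i|a f1 Cf i].
  - by rewrite bracket0l; exact: C0.
  - by rewrite bracketDl; exact: (CD _ _ (Cf i) (Cg i)).
  by rewrite bracketZl; exact: (CZ _ _ (Cf i)).
have lie2C : subset_of (lie_prod (@free_lie K) (@free_lie K)) C.
  move=> h hh; apply: (hh C C_subspace) => _ [f [g [fL gL ->]]].
  exact: (C_bracket _ _ (lieC _ fL) (lieC _ gL)).
move=> h hh; apply: (hh I) => [|_ [f [g [fLL _ ->]]]].
  by split; [exact: ideal0|exact: idealD|exact: idealZ].
exact: (C_central _ (lie2C _ fLL)).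
Qed.

End Ideal.

Lemma ideal_gen_ideal (P : A -> Prop) : two_sided_ideal (ideal_gen P).
Proof.
split=> [I II _|f g If Ig I II PI|f g Ig I II PI|f g If I II PI].
- exact: ideal0.
- by apply: (idealD II); [apply: If|apply: Ig].
- by apply: (idealMl II); apply: Ig.
- by apply: (idealMr II); apply: If.
Qed.

Lemma ideal_gen_sub (P : A -> Prop) : subset_of P (ideal_gen P).
Proof. by move=> f Pf I _ PI; apply: PI. Qed.

Section LinearExtension.
Variables (V : lmodType K) (F : word -> V).

Definition linext f : V := \sum_(m <- msupp f) f@_m *: F m.

Lemma linextE (d : {fset word}) f : (msupp f `<=` d)%fset ->
  linext f = \sum_(m <- d) f@_m *: F m.
Proof.
move=> fd; rewrite /linext (big_fset_incl _ fd) //= => m _ /mcoeff_outdom ->.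
by rewrite scale0r.
Qed.

Lemma linext_is_linear : linear linext.
Proof.
move=> c f g; pose d := (msupp f `|` msupp g)%fset.
rewrite (@linextE d f) ?fsubsetUl // (@linextE d g) ?fsubsetUr //.
rewrite (@linextE d); last first.
  apply: fsubset_trans (msuppD_le _ _) _.
  by apply: fsetUSS => //; apply: msuppZ_le.
rewrite scaler_sumr -big_split /=; apply: eq_bigr => m _.
by rewrite mcoeffD mcoeffZ scalerDl scalerA.
Qed.
HB.instance Definition _ :=
  GRing.isLinear.Build K A V _ linext linext_is_linear.

Lemma linextU (c : K) m : linext << c *g m >> = c *: F m.
Proof. by rewrite (linextE msuppU_le) big_seq_fset1 mcoeffUU. Qed.

End LinearExtension.

End FreeAlgebra.

(** * Right actions of the free algebra *)

Section RightAction.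
Variables (K : fieldType) (V : lmodType K) (op : nat -> {linear V -> V}).
Local Notation A := {freeAlg K}.
Implicit Types (v : V) (f g : A).

(** Words act from left to right, the first letter first, so that the product
    of the free algebra becomes composition in the opposite order. *)
Definition word_act (w : seq nat) v : V := foldl (fun u a => op a u) v w.

Lemma word_act_cat s t v : word_act (s ++ t) v = word_act t (word_act s v).
Proof. exact: foldl_cat. Qed.

Lemma word_act_is_linear s : linear (word_act s).
Proof.
by elim: s => [|a s IHs] c u v //=; rewrite /word_act /= linearP; apply: IHs.
Qed.
HB.instance Definition _ s :=
  GRing.isLinear.Build K V V _ (word_act s) (word_act_is_linear s).

Definition alg_act f v : V := linext (fun m : word => word_act m v) f.

Lemma alg_act0 v : alg_act 0 v = 0. Proof. exact: linear0. Qed.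
Lemma alg_actD f g v : alg_act (f + g) v = alg_act f v + alg_act g v.
Proof. exact: linearD. Qed.
Lemma alg_actB f g v : alg_act (f - g) v = alg_act f v - alg_act g v.
Proof. exact: linearB. Qed.
Lemma alg_actZ (c : K) f v : alg_act (c *: f) v = c *: alg_act f v.
Proof. exact: linearZ. Qed.

Lemma alg_act_wmon s v : alg_act (wmon K s) v = word_act s v.
Proof. by rewrite wmonE /alg_act linextU scale1r. Qed.

Lemma alg_act_letter i v : alg_act (letter K i) v = op i v.
Proof. by rewrite letterE alg_act_wmon. Qed.

Lemma alg_act_is_linear f : linear (alg_act f).
Proof.
move=> c u v; rewrite /alg_act /linext scaler_sumr -big_split /=.
by apply: eq_bigr => m _; rewrite linearP scalerDr !scalerA mulrC.
Qed.
HB.instance Definition _ f :=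
  GRing.isLinear.Build K V V _ (alg_act f) (alg_act_is_linear f).

Lemma alg_actM_wmon s g v :
  alg_act (wmon K s * g) v = alg_act g (word_act s v).
Proof.
elim/freeAlg_ind: g => [|g1 g2 IH1 IH2|d t].
- by rewrite mulr0 2!alg_act0.
- rewrite (mulrDr _ g1 g2) (alg_actD (_ * g1)) (alg_actD g1 g2).
  exact: (congr2 +%R IH1 IH2).
have -> : wmon K s * (d *: wmon K t) = d *: wmon K (s ++ t).
  by rewrite mulrZ wmonM.
apply: etrans (alg_actZ _ _ _) (etrans (congr1 _ _) (esym (alg_actZ _ _ _))).
by rewrite 2!alg_act_wmon word_act_cat.
Qed.

Lemma alg_actM f g v : alg_act (f * g) v = alg_act g (alg_act f v).
Proof.
elim/freeAlg_ind: f => [|f1 f2 IH1 IH2|c s].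
- by rewrite mul0r alg_act0 linear0.
- rewrite (mulrDl f1 f2 g) (alg_actD (f1 * g)) (alg_actD f1 f2) linearD.
  exact: (congr2 +%R IH1 IH2).
have R : alg_act g (alg_act (c *: wmon K s) v) = c *: alg_act g (word_act s v).
  by rewrite alg_actZ alg_act_wmon linearZ.
rewrite -(scalerAl c (wmon K s) g); apply: etrans (alg_actZ _ _ _) _.
exact: etrans (congr1 ( *:%R c) (alg_actM_wmon s g v)) (esym R).
Qed.

Definition killed f := forall v, alg_act f v = 0.

Lemma killed_ideal : two_sided_ideal killed.
Proof.
split=> [v|f g kf kg v|f g kg v|f g kf v].
- exact: alg_act0.
- by rewrite alg_actD kf kg addr0.
- by rewrite alg_actM kg.
by rewrite alg_actM kf linear0.
Qed.

Lemma alg_act_bracket f g v :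
  alg_act [< f, g >] v = alg_act g (alg_act f v) - alg_act f (alg_act g v).
Proof.
exact: etrans (alg_actB _ _ _)
  (congr2 (fun x y => x - y) (alg_actM _ _ _) (alg_actM _ _ _)).
Qed.

(** If the commutator of two letters commutes with the action of every letter,
    the kernel of the action contains all brackets [[x_i, x_j], x_k]. *)
Lemma killed_gamma3 :
  (forall i j k v, op k (op j (op i v) - op i (op j v))
     = op j (op i (op k v)) - op i (op j (op k v))) ->
  subset_of (@gamma3 K) killed.
Proof.
move=> op_comm; apply: (gamma3_in_ideal killed_ideal) => i j k v.
pose b u := op j (op i u) - op i (op j u).
have act_b u : alg_act [< letter K i, letter K j >] u = b u.
  by rewrite alg_act_bracket 4!alg_act_letter.
have E1 := etrans (alg_act_letter k _) (congr1 (op k) (act_b v)).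
have E2 := etrans (act_b _) (congr1 b (alg_act_letter k v)).
apply: etrans (alg_act_bracket _ _ _) _.
apply: etrans (congr2 (fun x y => x - y) E1 E2) _.
by rewrite /b op_comm subrr.
Qed.

End RightAction.

(** * The polynomial model of the class 2 enveloping algebra *)

Lemma seq_argmax (T : eqType) (f : T -> nat) (s : seq T) (x : T) :
  x \in s -> exists2 u, u \in s & {in s, forall v, (f v <= f u)%N}.
Proof.
elim: s x => // y [_ _ _|x s IHs _ _].
  by exists y; rewrite ?mem_head // => v; rewrite inE => /eqP ->.
have [u us umax] := IHs x (mem_head _ _).
have [le_yu|lt_uy] := leqP (f y) (f u).
  exists u; first by rewrite inE us orbT.
  by move=> v; rewrite inE => /predU1P[-> //|]; apply: umax.
exists y; first exact: mem_head.
move=> v; rewrite inE => /predU1P[-> //|/umax /leq_trans]; apply; exact: ltnW.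
Qed.

(** Multivariate polynomials and monoid algebras share many names; the module
    keeps the former local. *)
Module PBW.
Import mpoly.

Section Model.
Variables (K : fieldType) (n' : nat).
Local Notation n := n'.+1.
Local Notation N := #|{: 'I_n * 'I_n}|.
Local Notation P := {mpoly K[N]}.
Implicit Types (i j k : 'I_n) (p q : P) (w : seq nat).

(** One variable for each pair of letters: (i, i) is t_i, and (a, b) with
    a > b is z_ab.  It is the variable of the item with the same name. *)
Definition var i j : 'I_N := enum_rank (i, j).
Definition tvar i : 'I_N := var i i.

(** Moving the letter x_i to the left past a letter x_j with j > i, in order to
    sort a product of letters, costs the commutator z_ji. *)
Definition cder i p : P :=
  \sum_(j : 'I_n | (i < j)%N) 'X_(var j i) * p^`M(tvar j).
Definition mulr_letter i p : P := 'X_(tvar i) * p + cder i p.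

Lemma var_eq i j k l : (var i j == var k l) = ((i, j) == (k, l)).
Proof. by rewrite (inj_eq enum_rank_inj). Qed.

Lemma mderiv_var (x y : 'I_N) : ('X_x : P)^`M(y) = (x == y)%:R.
Proof.
rewrite mderivX mnm1E; case: eqP => [->|_]; last by rewrite scale0r.
by rewrite scale1r -[X in (X - _)%MM]add0m addmK mpolyX0.
Qed.

Lemma cder_is_linear i : linear (cder i).
Proof.
move=> c p q; rewrite /cder scaler_sumr -big_split /=; apply: eq_bigr => j _.
by rewrite mderivD mderivZ mulrDr scalerAr.
Qed.
HB.instance Definition _ i :=
  GRing.isLinear.Build K P P _ (cder i) (cder_is_linear i).

Lemma cderM i p q : cder i (p * q) = cder i p * q + p * cder i q.
Proof.
rewrite /cder mulr_suml mulr_sumr -big_split /=; apply: eq_bigr => j _.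
by rewrite mderivM mulrDr !mulrA [p * 'X_ _]mulrC.
Qed.

Lemma cder_tvar i k :
  cder i 'X_(tvar k) = if (i < k)%N then 'X_(var k i) else 0.
Proof.
rewrite /cder; case: ifP => ik.
  rewrite (bigD1 k) //= mderiv_var eqxx mulr1 big1 ?addr0 // => j /andP[_ jk].
  by rewrite mderiv_var /tvar var_eq xpair_eqE andbb eq_sym (negbTE jk) mulr0.
rewrite big1 // => j ij; rewrite mderiv_var /tvar var_eq xpair_eqE andbb.
by case: eqP => [jk|_]; [rewrite -jk ik in ij | rewrite mulr0].
Qed.

Lemma mderiv_zvar i j k : (j < i)%N -> ('X_(var i j) : P)^`M(tvar k) = 0.
Proof.
move=> ji; rewrite mderiv_var /tvar var_eq xpair_eqE.
by case: eqP => //= ik; case: eqP => //= jk; rewrite ik jk ltnn in ji.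
Qed.

Lemma cder_zvar i k (l : 'I_n) : (k < l)%N -> cder i 'X_(var l k) = 0.
Proof.
by move=> kl; rewrite /cder big1 // => j _; rewrite mderiv_zvar // mulr0.
Qed.

Lemma cder_comm i k p : cder i (cder k p) = cder k (cder i p).
Proof.
have aux a b : cder a (cder b p) =
    \sum_(l : 'I_n | (b < l)%N) \sum_(j : 'I_n | (a < j)%N)
      'X_(var j a) * 'X_(var l b) * p^`M(tvar j)^`M(tvar l).
  rewrite [cder b p]/cder linear_sum /=; apply: eq_bigr => l bl.
  rewrite cderM cder_zvar // mul0r add0r /cder mulr_sumr.
  apply: eq_bigr => j _.
  by rewrite mderiv_comm mulrCA mulrA.
rewrite !aux exchange_big; apply: eq_bigr => j _; apply: eq_bigr => l _.
by rewrite mderiv_comm ['X_(var l _) * _]mulrC.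
Qed.

(** The commutator [x_k, x_i]: z_ki if i < k, - z_ik if k < i, else 0. *)
Definition comm_coef i k : P := cder i 'X_(tvar k) - cder k 'X_(tvar i).

(** The derivations [cder i] commute, so only the action of one operator on the
    variable t of the other survives in the commutator. *)
Lemma mulr_letter_comm i k p :
  mulr_letter i (mulr_letter k p) - mulr_letter k (mulr_letter i p)
    = comm_coef i k * p.
Proof.
rewrite /mulr_letter !linearD /= !cderM !mulrDr cder_comm /comm_coef.
rewrite mulrBl mulrCA; ring.
Qed.

Lemma mulr_letter_comm_coef i j k p :
  mulr_letter i (comm_coef j k * p) = comm_coef j k * mulr_letter i p.
Proof.
rewrite /mulr_letter cderM mulrDr mulrCA; congr (_ + _).
suff -> : cder i (comm_coef j k) = 0 by rewrite mul0r add0r.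
rewrite /comm_coef linearB /= !cder_tvar; do 2!case: ifP => ?;
  rewrite ?cder_zvar ?linear0 ?subr0 ?oppr0 ?addr0 //.
Qed.

Lemma mulr_letter_is_linear i : linear (mulr_letter i).
Proof.
move=> c p q; rewrite /mulr_letter linearP mulrDr scalerDr -scalerAr.
by rewrite addrACA.
Qed.
HB.instance Definition _ i :=
  GRing.isLinear.Build K P P _ (mulr_letter i) (mulr_letter_is_linear i).

(** The number n' is chosen later as a bound for all letters in sight; larger
    letters act like the letter 0. *)
Definition letter_op (a : nat) : {linear P -> P} := mulr_letter (inord a).
Local Notation act := (word_act letter_op).

Lemma letter_op_comm a b c p :
  letter_op c (letter_op b (letter_op a p) - letter_op a (letter_op b p))
  = letter_op b (letter_op a (letter_op c p))
    - letter_op a (letter_op b (letter_op c p)).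
Proof. by rewrite /= !mulr_letter_comm mulr_letter_comm_coef. Qed.

(** The weight of z_ab is its upper index a, that of t_i is 0.  A letter b
    acting just after a on a product of letters up to a produces z_jb only for
    j <= a, and z_ab is the heaviest of these. *)
Definition wt (m : 'X_{1..N}) : nat :=
  \sum_x m x * (let: (a, b) := enum_val x in if a == b then 0 else a).

Lemma wtD m1 m2 : wt (m1 + m2)%MM = (wt m1 + wt m2)%N.
Proof.
by rewrite /wt -big_split /=; apply: eq_bigr => x _; rewrite mnmDE mulnDl.
Qed.

Lemma wt_var i j : wt U_(var i j)%MM = if i == j then 0%N else i.
Proof.
rewrite /wt (bigD1 (var i j)) //= mnm1E eqxx mul1n enum_rankK.
rewrite big1 ?addn0 // => x; rewrite mnm1E eq_sym => /negbTE -> //.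
Qed.

Definition low (k : nat) p : bool := all (fun m => wt m < k)%N (msupp p).

Lemma low0 (k : nat) : low k 0.
Proof. by apply/allP=> m; rewrite mcoeff_msupp mcoeff0 eqxx. Qed.

Lemma lowD (k : nat) p q : low k p -> low k q -> low k (p + q).
Proof.
move=> /allP lp /allP lq; apply/allP => m /msuppD_le; rewrite mem_cat.
by case/orP => [/lp|/lq].
Qed.

Lemma low_weak (k l : nat) p : (k <= l)%N -> low k p -> low l p.
Proof. by move=> kl; apply: sub_all => m /leq_trans; apply. Qed.

Lemma lowX m (k : nat) : (wt m < k)%N -> low k 'X_[m].
Proof. by rewrite /low msuppX /= andbT. Qed.

Lemma lowM (k : nat) m p : low k p -> low (wt m + k) ('X_[m] * p).
Proof.
move=> /allP lp; rewrite /low mulrC (perm_all _ (msuppMX _ _)) all_map.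
by apply/allP => m' /lp; rewrite /= wtD ltn_add2l.
Qed.

Lemma low_mderiv (k : nat) x p : low k p -> low k p^`M(x).
Proof.
move=> /allP lp; apply/allP => m; rewrite mcoeff_msupp mcoeff_deriv => h.
have : (m + U_(x))%MM \in msupp p.
  by rewrite mcoeff_msupp; apply: contraNneq h => ->; rewrite mul0rn.
by move/lp; rewrite wtD; apply: leq_ltn_trans; apply: leq_addr.
Qed.

Lemma low_mcoeff (k : nat) m p : low k p -> (k <= wt m)%N -> p@_m = 0.
Proof.
move=> /allP lp km; apply/eqP; rewrite mcoeff_eq0; apply/negP => /lp.
by rewrite ltnNge km.
Qed.

Lemma act_rcons w a p : act (rcons w a) p = mulr_letter (inord a) (act w p).
Proof. by rewrite -cats1 word_act_cat. Qed.

Lemma mderiv_act w (j : 'I_n) :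
  all (fun a => a < j)%N w -> (act w 1)^`M(tvar j) = 0.
Proof.
elim/last_ind: w => [_|w a IHw]; first by rewrite -mpolyC1 mderivC.
rewrite all_rcons act_rcons => /andP[aj /IHw {}IHw].
have an : (a < n)%N by apply: ltn_trans aj (ltn_ord j).
rewrite /mulr_letter mderivD mderivM IHw mulr0 addr0 mderiv_var /tvar var_eq.
rewrite xpair_eqE andbb -val_eqE /= inordK // (ltn_eqF aj) mul0r add0r.
rewrite /cder linear_sum big1 //= => k ak.
by rewrite mderivM mderiv_zvar // mul0r add0r mderiv_comm IHw mderiv0 mulr0.
Qed.

(** A letter not exceeded by any earlier one has nothing to move past. *)
Lemma mulr_letter_top (i : 'I_n) w : all (fun a => a <= i)%N w ->
  mulr_letter i (act w 1) = 'X_(tvar i) * act w 1.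
Proof.
move=> wi; rewrite /mulr_letter /cder big1 ?addr0 // => j ij.
rewrite mderiv_act ?mulr0 //; apply: sub_all wi => a ai.
exact: leq_ltn_trans ij.
Qed.

Definition item_var (p : nat * nat) : 'I_N := var (inord p.1) (inord p.2).
Definition expo (s : seq (nat * nat)) : 'X_{1..N} :=
  (\sum_(p <- s) U_(item_var p))%MM.

Definition item_valid (p : nat * nat) : bool := (p.2 <= p.1 < n)%N.

Lemma spell_rcons s (p : nat * nat) :
  spell (rcons s p) = spell s ++ item_word p.
Proof. by rewrite /spell map_rcons flatten_rcons. Qed.

Lemma expo_rcons s (p : nat * nat) :
  expo (rcons s p) = (U_(item_var p) + expo s)%MM.
Proof. by rewrite /expo -cats1 big_cat big_seq1 addmC. Qed.

Lemma item_var_inj : {in item_valid &, injective item_var}.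
Proof.
move=> [a b] [c d]; rewrite -!topredE /= /item_valid /= => ab cd /eqP.
rewrite /item_var var_eq => /eqP[/(congr1 val) /= + /(congr1 val) /=].
rewrite !inordK; first (by move=> -> ->); lia.
Qed.

Lemma expoE s (p : nat * nat) : all item_valid s -> item_valid p ->
  expo s (item_var p) = count_mem p s.
Proof.
move=> sv pv; elim: s sv => [|q s IHs] /=; first by rewrite /expo big_nil mnm0E.
move=> /andP[qv /IHs {}IHs]; rewrite /expo big_cons mnmDE IHs mnm1E.
by rewrite (inj_in_eq item_var_inj).
Qed.

(** The exponent vector counts the items, and a sorted list is determined by
    its multiplicities. *)
Lemma expo_inj s1 s2 : all item_valid s1 -> all item_valid s2 ->
  sorted item_le s1 -> sorted item_le s2 -> expo s1 = expo s2 -> s1 = s2.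
Proof.
move=> v1 v2 o1 o2 e12; apply: (sorted_eq item_le_trans item_le_anti) => //.
apply/allP => p; rewrite mem_cat => p12; apply/eqP.
have pv : item_valid p by case/orP: p12 => [/(allP v1)|/(allP v2)].
by rewrite -!expoE // e12.
Qed.

(** Triangularity.  Append an item (a, b) to the word w of the items below it,
    whose letters are at most a; write p for the image of 1 under w.  The letter
    a turns p into t_a p.  If b < a, the letter b turns this into
      t_b t_a p + sum over j > b of z_jb d/dt_j (t_a p),
    where the terms with j > a vanish and those with j < a, as well as
    t_b t_a p, are too light.  The term j = a is z_ab (p + t_a dp/dt_a), and the
    leading monomial of p is free of t_a because the item (a, a) would come
    after (a, b); so z_ab times that monomial appears exactly once. *)
Lemma act_spell s : all item_valid s -> sorted item_le s ->
  exists2 q : P, act (spell s) 1 = 'X_[expo s] + q & low (wt (expo s)) q.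
Proof.
elim/last_ind: s => [_ _|s [a b] IHs].
  by exists 0; [rewrite /expo big_nil mpolyX0 addr0|exact: low0].
rewrite all_rcons => /andP[/andP[/= ba an] vs] so.
have le_s : all (item_le^~ (a, b)) s.
  move: so; rewrite -rev_sorted rev_rcons /= => so.
  rewrite -all_rev; apply: order_path_min so => x y z /[swap].
  exact: item_le_trans.
have [|q qE ql] := IHs vs.
  by move: so; rewrite -cats1 => /cat_sorted2[].
have wa : all (fun c => c <= a)%N (spell s).
  apply/allP => c /flatten_mapP[[d e] ds].
  have /andP[/= ed _] := allP vs _ ds; have := allP le_s _ ds.
  by rewrite /item_le /item_word /= => ?; case: ifP; rewrite !inE; lia.
set i : 'I_n := inord a; have iE : i = a :> nat by rewrite inordK.
have act_a : mulr_letter i (act (spell s) 1) = 'X_(tvar i) * act (spell s) 1.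
  by apply: mulr_letter_top; rewrite iE.
rewrite spell_rcons word_act_cat expo_rcons mpolyXD /item_word /item_var /= -/i.
rewrite wtD wt_var.
case: ltnP => [lt_ba|ge_ba]; last first.
  have {ge_ba} <- : a = b by lia.
  rewrite -/i eqxx /= act_a qE mulrDr; exists ('X_(tvar i) * q) => //.
  by have := lowM U_(tvar i)%MM ql; rewrite wt_var eqxx.
rewrite /= act_a; set k : 'I_n := inord b.
have kE : k = b :> nat by rewrite inordK // (leq_ltn_trans ba).
have ik : (k < i)%N by rewrite iE kE.
have nik : (i == k) = false by rewrite -val_eqE /= gtn_eqF.
rewrite nik.
set p := act (spell s) 1 in qE act_a *.
have dX : ('X_[expo s] : P)^`M(tvar i) = 0.
  rewrite mderivX /tvar -[var i i]/(item_var (a, a)) expoE //; last first.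
    by rewrite /item_valid /= leqnn.
  suff -> : count_mem (a, a) s = 0%N by rewrite scale0r.
  apply/count_memPn/negP => /(allP le_s); rewrite /item_le /=; lia.
have lp : low (wt (expo s)).+1 p.
  by rewrite qE; apply: lowD; [apply: lowX|apply: low_weak ql].
have ltp : low (wt (expo s)).+1 ('X_(tvar i) * p).
  by have := lowM U_(tvar i)%MM lp; rewrite wt_var eqxx.
have pD : p^`M(tvar i) = q^`M(tvar i) by rewrite qE mderivD dX add0r.
exists ('X_(tvar k) * ('X_(tvar i) * p)
  + ('X_(var i k) * (q + 'X_(tvar i) * q^`M(tvar i))
     + \sum_(j : 'I_n | (k < j)%N && (j != i))
         'X_(var j k) * ('X_(tvar i) * p)^`M(tvar j))).
  rewrite {1}/mulr_letter /cder (bigD1 i) //= mderivM mderiv_var eqxx mul1r pD.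
  rewrite [RHS]addrCA; congr (_ + _); rewrite addrA; congr (_ + _).
  by rewrite -mulrDr {1}qE addrA.
apply: lowD.
  have := lowM U_(tvar k)%MM ltp; rewrite wt_var eqxx add0n; apply: low_weak.
  by rewrite -add1n leq_add2r (leq_ltn_trans (leq0n _) ik).
apply: lowD.
  have lq : low (wt (expo s)) (q + 'X_(tvar i) * q^`M(tvar i)).
    apply: lowD => //.
    by have := lowM U_(tvar i)%MM (low_mderiv (tvar i) ql); rewrite wt_var eqxx.
  by have := lowM U_(var i k)%MM lq; rewrite wt_var nik.
elim/big_ind: _ => [||j /andP[kj ji]]; [exact: low0|by move=> *; apply: lowD|].
case: (ltngtP j i) => [lt_ji|lt_ij|/val_inj e]; last by rewrite e eqxx in ji.
  have := lowM U_(var j k)%MM (low_mderiv (tvar j) ltp).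
  rewrite wt_var -val_eqE /= gtn_eqF //; apply: low_weak.
  by rewrite addnS -addSn leq_add2r.
rewrite mderivM mderiv_var /tvar var_eq xpair_eqE andbb -val_eqE /= ltn_eqF //.
rewrite mul0r add0r.
rewrite mderiv_act ?mulr0; first exact: low0.
by apply: sub_all wa => c ca; rewrite (leq_ltn_trans ca) // -iE.
Qed.

Lemma act_normal w : normal w -> all (fun a => a < n)%N w ->
  [/\ all item_valid (items w) &
  exists2 q : P, act w 1 = 'X_[expo (items w)] + q
    & low (wt (expo (items w))) q].
Proof.
move=> /and3P[/eqP sw so ok] wn.
have vw : all item_valid (items w).
  apply/allP => -[a b] abw; rewrite /item_valid (allP ok _ abw) /=.
  apply: (allP wn); rewrite -sw; apply/flatten_mapP; exists (a, b) => //.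
  by rewrite /item_word /=; case: ifP; rewrite inE eqxx.
by split=> //; have := act_spell vw so; rewrite sw.
Qed.

(** Look at the coefficient of the leading monomial of a normal word of maximal
    weight: no other word contributes to it. *)
Lemma act_independent (c : seq nat -> K) (r : seq (seq nat)) :
  uniq r -> all normal r -> all (all (fun a => a < n)%N) r ->
  \sum_(w <- r) c w *: act w 1 = 0 -> {in r, forall w, c w = 0}.
Proof.
move=> ur nr br sum0 w wr; apply/eqP; apply: contraT => cw.
pose f u := wt (expo (items u)).
pose r' := [seq u <- r | c u != 0].
have wr' : w \in r' by rewrite mem_filter cw.
have [u ur' umax] : exists2 u, u \in r' & {in r', forall v, (f v <= f u)%N}.
  exact: seq_argmax wr'.
move: ur'; rewrite mem_filter => /andP[cu u_r].
have [uv [q qE ql]] := act_normal (allP nr _ u_r) (allP br _ u_r).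
have := congr1 (mcoeff (expo (items u))) sum0.
rewrite mcoeff0 (raddf_sum (mcoeff _)) (bigD1_seq u) //= big_seq_cond big1.
  rewrite addr0 mcoeffZ qE mcoeffD mcoeffX eqxx.
  have -> : q@_(expo (items u)) = 0.
    exact: low_mcoeff ql _.
  by rewrite addr0 mulr1 => /eqP; rewrite (negbTE cu).
move=> v /andP[v_r vu]; rewrite mcoeffZ.
have [->|cv] := eqVneq (c v) 0; first by rewrite mul0r.
have [vv [q' q'E q'l]] := act_normal (allP nr _ v_r) (allP br _ v_r).
have fvu : (f v <= f u)%N by apply: umax; rewrite mem_filter cv.
rewrite q'E mcoeffD mcoeffX.
have -> : q'@_(expo (items u)) = 0 by exact: low_mcoeff q'l fvu.
case: eqP => [e|_]; last by rewrite addr0 mulr0.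
have /and3P[/eqP sv ov _] := allP nr _ v_r.
have /and3P[/eqP su ou _] := allP nr _ u_r.
by case/eqP: vu; rewrite -sv -su (expo_inj vv uv ov ou e).
Qed.

End Model.

Lemma normal_combination_eq0 (K : fieldType) (f : {freeAlg K}) :
  ideal_gen (@gamma3 K) f -> (forall m, m \in monalg.msupp f -> normal m) ->
  f = 0.
Proof.
move=> If nf; pose r : seq (seq nat) := map (@fmonom_val nat) (monalg.msupp f).
pose n := \max_(w <- r) \max_(a <- w) a.
have kf : killed (@letter_op K n) f.
  apply: If; [exact: killed_ideal|apply: killed_gamma3 => *].
  exact: letter_op_comm.
apply/monalg.malgP => m; rewrite monalg.mcoeff0.
have [mf|] := boolP (m \in monalg.msupp f); last exact: monalg.mcoeff_outdom.
have ur : uniq r by rewrite map_inj_uniq ?fset_uniq //; apply: val_inj.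
have nr : all normal r by apply/allP => _ /mapP[m' m'f ->]; apply: nf.
have br : all (all (fun a => a < n.+1)%N) r.
  apply/allP => w wr; apply/allP => a aw; rewrite ltnS.
  have le_aw : (a <= \max_(b <- w) b)%N.
    exact: (@leq_bigmax_seq _ _ xpredT id).
  apply: leq_trans le_aw _.
  exact: (@leq_bigmax_seq _ _ xpredT (fun u : seq nat => \max_(b <- u) b)).
have := act_independent (c := fun s => monalg.mcoeff (FMonom s) f) ur nr br.
rewrite big_map => ind.
have -> : monalg.mcoeff m f = monalg.mcoeff (FMonom m) f by rewrite word_eta.
apply: ind; last exact: map_f.
rewrite -[RHS](kf 1); apply: eq_bigr => m' _; by rewrite word_eta.
Qed.
End PBW.

(** * Relabellings and leading words *)

Section Relabel.
Variables (K : fieldType) (h : nat -> nat).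
Local Notation A := {freeAlg K}.

Definition relabel : A -> A := linext (fun m : word => wmon K (map h m)).

HB.instance Definition _ := GRing.Linear.on relabel.

Lemma relabel_wmon s : relabel (wmon K s) = wmon K (map h s).
Proof. by rewrite wmonE /relabel linextU scale1r. Qed.

Lemma relabelD f g : relabel (f + g) = relabel f + relabel g.
Proof. exact: linearD. Qed.

Lemma relabelZ (c : K) f : relabel (c *: f) = c *: relabel f.
Proof. exact: linearZ. Qed.

Lemma relabel_monoid : monoid_morphism relabel.
Proof.
split; first by rewrite -wmon0 relabel_wmon.
move=> f g; elim/freeAlg_ind: f => [|f1 f2 IH1 IH2|c s].
- by rewrite mul0r linear0 mul0r.
- by rewrite (mulrDl f1) 2!relabelD (mulrDl (relabel f1));
    exact: (congr2 +%R IH1 IH2).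
elim/freeAlg_ind: g => [|g1 g2 IH1 IH2|d t].
- by rewrite mulr0 linear0 mulr0.
- by rewrite (mulrDr _ g1) 2!relabelD (mulrDr _ (relabel g1));
    exact: (congr2 +%R IH1 IH2).
have E : relabel (wmon K s * wmon K t) =
    relabel (wmon K s) * relabel (wmon K t).
  by rewrite wmonM !relabel_wmon wmonM map_cat.
have S (x y : A) : (c *: x) * (d *: y) = d *: (c *: (x * y)).
  by rewrite mulrZ -scalerAl.
have L := etrans (congr1 relabel (S (wmon K s) (wmon K t)))
  (etrans (relabelZ d _) (congr1 ( *:%R d) (relabelZ c _))).
have R := etrans (congr2 *%R (relabelZ c (wmon K s)) (relabelZ d (wmon K t)))
  (S _ _).
exact: etrans L (etrans (congr1 ( *:%R d) (congr1 ( *:%R c) E)) (esym R)).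
Qed.
HB.instance Definition _ :=
  GRing.isMonoidMorphism.Build A A relabel relabel_monoid.

Definition relabel_lr : {lrmorphism A -> A} := relabel.

Lemma relabel_letter i : relabel (letter K i) = letter K (h i).
Proof. by rewrite !letterE relabel_wmon. Qed.

Lemma relabel_monotone :
  {homo h : i j / (i < j)%N} -> monotone_endo relabel_lr.
Proof.
move=> hh; split=> [i|i j k l /hh].
  by exists (h i); apply: relabel_letter.
by rewrite /= !relabel_letter => + /letter_inj <- /letter_inj <-.
Qed.

End Relabel.

(** Each expansion displays the leading word first.  They are stated for any
    family of ring elements indexed multiplicatively by words. *)
Section BracketExpansion.
Variables (R : nzRingType) (mon : seq nat -> R).
Hypothesis monM : forall s t, mon s * mon t = mon (s ++ t).
Local Notation x i := (mon [:: i]).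
Implicit Types i j k l : nat.

Lemma bracket_expand_l i j k : [< [< x i, x j >], x k >] =
  mon [:: i; j; k]
  + (- mon [:: j; i; k] + (mon [:: k; j; i] - mon [:: k; i; j])).
Proof. by rewrite /bracket mulrBl mulrBr !monM opprB -!addrA. Qed.

Lemma bracket_expand_r i j k : [< x i, [< x j, x k >] >] =
  mon [:: i; j; k]
  + (- mon [:: i; k; j] + (mon [:: k; j; i] - mon [:: j; k; i])).
Proof. by rewrite /bracket mulrBl mulrBr !monM opprB -!addrA. Qed.

Lemma bracket_expand_lr i j k l : [< [< x i, x j >], [< x k, x l >] >] =
  mon [:: i; j; k; l] + (- mon [:: i; j; l; k]
    + (mon [:: j; i; l; k] - mon [:: j; i; k; l])
    + (mon [:: l; k; i; j] - mon [:: l; k; j; i]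
       + (mon [:: k; l; j; i] - mon [:: k; l; i; j]))).
Proof.
by rewrite /bracket !mulrBl !mulrBr !monM /= !opprB -!addrA.
Qed.
End BracketExpansion.

Section Supports.
Variable K : fieldType.
Local Notation A := {freeAlg K}.

Definition supp_in (Q : word -> Prop) (f : A) := forall m, m \in msupp f -> Q m.

Lemma supp_inD Q f g : supp_in Q f -> supp_in Q g -> supp_in Q (f + g).
Proof.
move=> Qf Qg m /(fsubsetP (msuppD_le f g)); rewrite inE.
by case/orP => [/Qf|/Qg].
Qed.

Lemma supp_inN Q f : supp_in Q f -> supp_in Q (- f).
Proof. by move=> Qf m; rewrite msuppN => /Qf. Qed.

Lemma supp_inZ Q c f : supp_in Q f -> supp_in Q (c *: f).
Proof. by move=> Qf m /(fsubsetP (msuppZ_le c f)) /Qf. Qed.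

Lemma supp_in0 Q : supp_in Q 0.
Proof. by move=> m; rewrite msupp0 inE. Qed.

Lemma supp_in_wmon (Q : word -> Prop) s : Q (FMonom s) -> supp_in Q (wmon K s).
Proof. by move=> Qs m; rewrite wmonE msuppU1 inE => /eqP ->. Qed.

Lemma supp_expand (f : A) : f = \sum_(m <- msupp f) f@_m *: wmon K m.
Proof.
rewrite [LHS]monalgE; apply: eq_bigr => m _.
by rewrite wmonZ word_eta.
Qed.

Lemma supp_linext (L : {linear A -> A}) (Q Q' : word -> Prop) f :
  (forall m, Q m -> supp_in Q' (L (wmon K m))) -> supp_in Q f ->
  supp_in Q' (L f).
Proof.
move=> QQ' Qf; rewrite [f]supp_expand linear_sum big_seq.
elim/big_ind: _ => [||m mf]; [exact: supp_in0|exact: supp_inD|].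
rewrite linearZ; exact: supp_inZ (QQ' _ (Qf _ mf)).
Qed.

(** The leading coefficient is 1 for every generator and relabelling, whatever
    the characteristic. *)
Definition led_by (s : seq nat) (f : A) :=
  exists2 q, f = wmon K s + q & supp_in (fun m => below s m) q.

Lemma led_by_lead s f : led_by s f -> f != 0 /\ lead_word f = FMonom s.
Proof.
move=> [q -> qs].
have cs : (wmon K s + q)@_(FMonom s) = 1.
  rewrite mcoeffD {1}wmonE mcoeffUU mcoeff_outdom ?addr0 //; apply/negP => /qs.
  by rewrite /below => /andP[_]; elim: (s) => //= a t IHt; rewrite ltnn eqxx.
have f0 : wmon K s + q != 0.
  by apply/eqP => f0; move/eqP: cs; rewrite f0 mcoeff0 eq_sym oner_eq0.
split=> //.
have sf : FMonom s \in msupp (wmon K s + q) by rewrite -mcoeff_neq0 cs oner_eq0.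
have lf := lead_word_msupp f0; have sl := lead_word_greatest sf.
have := fsubsetP (msuppD_le _ _) _ lf; rewrite inE.
case/orP => [|/qs]; first by rewrite wmonE msuppU1 inE => /eqP.
move/(@below_deglex (FMonom s)) => /andP[ls /eqP[]].
by apply: deglex_anti; rewrite ls sl.
Qed.

Lemma led_by_relabel h s f : {homo h : i j / (i < j)%N} ->
  led_by s f -> led_by (map h s) (relabel h f).
Proof.
move=> hh [q -> qs]; exists (relabel h q).
  by rewrite relabelD relabel_wmon.
apply: (supp_linext _ qs) => m sm; rewrite /= relabel_wmon.
by apply: supp_in_wmon; apply: below_map.
Qed.

Definition generators : seq A :=
  let x1 := letter K 0 in let x2 := letter K 1 in let x3 := letter K 2 in
  [:: [< [< x2, x1 >], x1 >]; [< x2, [< x2, x1 >] >]; [< x3, [< x2, x1 >] >];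
      [< [< x3, x1 >], x2 >]; [< [< x3, x2 >], [< x3, x1 >] >] ].

Lemma led_by_bracket_l i j k :
  below [:: i; j; k] [:: j; i; k] -> below [:: i; j; k] [:: k; j; i] ->
  below [:: i; j; k] [:: k; i; j] ->
  led_by [:: i; j; k] [< [< letter K i, letter K j >], letter K k >].
Proof.
move=> b1 b2 b3; rewrite !letterE (bracket_expand_l (@wmonM K)).
eexists; first by [].
apply: supp_inD; first by apply: supp_inN; apply: supp_in_wmon; exact: b1.
apply: supp_inD; first by apply: supp_in_wmon; exact: b2.
by apply: supp_inN; apply: supp_in_wmon; exact: b3.
Qed.

Lemma led_by_bracket_r i j k :
  below [:: i; j; k] [:: i; k; j] -> below [:: i; j; k] [:: k; j; i] ->
  below [:: i; j; k] [:: j; k; i] ->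
  led_by [:: i; j; k] [< letter K i, [< letter K j, letter K k >] >].
Proof.
move=> b1 b2 b3; rewrite !letterE (bracket_expand_r (@wmonM K)).
eexists; first by [].
apply: supp_inD; first by apply: supp_inN; apply: supp_in_wmon; exact: b1.
apply: supp_inD; first by apply: supp_in_wmon; exact: b2.
by apply: supp_inN; apply: supp_in_wmon; exact: b3.
Qed.

Lemma led_by_bracket_lr : led_by [:: 2; 1; 2; 0]%N
  [< [< letter K 2, letter K 1 >], [< letter K 2, letter K 0 >] >].
Proof.
rewrite !letterE (bracket_expand_lr (@wmonM K)); eexists; first by [].
by do 4!(try apply: supp_inD; try apply: supp_inN); apply: supp_in_wmon.
Qed.

Lemma obstruction_led s : s \in obstructions ->
  exists2 g, g \in generators & led_by s g.
Proof.
rewrite !inE => /or4P[| | |/orP[|]] /eqP ->.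
- exists [< [< letter K 1, letter K 0 >], letter K 0 >].
    exact: mem_head.
  exact: led_by_bracket_l.
- exists [< letter K 1, [< letter K 1, letter K 0 >] >].
    exact: (mem_nth 0 (isT : (1 < size generators)%N)).
  exact: led_by_bracket_r.
- exists [< letter K 2, [< letter K 1, letter K 0 >] >].
    exact: (mem_nth 0 (isT : (2 < size generators)%N)).
  exact: led_by_bracket_r.
- exists [< [< letter K 2, letter K 0 >], letter K 1 >].
    exact: (mem_nth 0 (isT : (3 < size generators)%N)).
  exact: led_by_bracket_l.
exists [< [< letter K 2, letter K 1 >], [< letter K 2, letter K 0 >] >].
  exact: (mem_nth 0 (isT : (4 < size generators)%N)).
exact: led_by_bracket_lr.
Qed.
End Supports.

(** * Reduction to normal words *)

Section NormalForm.
Variables (K : fieldType) (I : {freeAlg K} -> Prop).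
Local Notation A := {freeAlg K}.
Hypothesis idealI : two_sided_ideal I.

Lemma combine_reductions (Q : word -> Prop) (q : A) :
  supp_in (fun m => exists2 r, I (wmon K m - r) & supp_in Q r) q ->
  exists2 r, I (q - r) & supp_in Q r.
Proof.
move=> red; rewrite [q]supp_expand.
have : {subset (msupp q : seq word) <= msupp q} by [].
elim: (msupp q : seq word) => [_|m s IHs sub].
  exists 0; last exact: supp_in0.
  by rewrite big_nil subrr; exact: ideal0.
have [|r1 Ir1 Qr1] := IHs.
  by move=> x xs; apply: sub; rewrite inE xs orbT.
have [r2 Ir2 Qr2] := red m (sub m (mem_head _ _)).
exists (q@_m *: r2 + r1); last by apply: supp_inD Qr1; apply: supp_inZ.
rewrite big_cons opprD addrACA -scalerBr.
exact: (idealD idealI (idealZ idealI _ Ir2) Ir1).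
Qed.

Hypothesis obstructed : forall (h : nat -> nat) s,
  {homo h : a b / (a < b)%N} -> s \in obstructions ->
  exists2 g, I g & led_by (map h s) g.

(** An obstruction inside w is the leading word of some g in I; subtracting the
    corresponding multiple of g replaces w by a combination of words below w,
    to which induction applies. *)
Lemma normal_form (w : seq nat) : exists2 r, I (wmon K w - r) &
  supp_in (fun m => normal m /\ ((m : seq nat) = w \/ below w m)) r.
Proof.
elim/below_ind: w => w IHw.
have [nw|[h [s hh /andP[sO /infixP[x [y wE]]]]]] := normal_or_obstructed w.
  exists (wmon K w); first by rewrite subrr; apply: ideal0.
  by apply: supp_in_wmon; split=> //; left.
have [g Ig [q gE qs]] := obstructed hh sO.
pose q' := wmon K x * q * wmon K y.
have Iq' : I (wmon K w + q').
  have -> : wmon K w + q' = wmon K x * g * wmon K y.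
    by rewrite gE mulrDr mulrDl !wmonM -catA -wE.
  exact: (idealMr idealI _ (idealMl idealI _ Ig)).
have below_q' : supp_in (fun m => below w m) q'.
  have lin : linear (fun f : A => wmon K x * f * wmon K y).
    by move=> c f1 f2; rewrite mulrDr mulrDl mulrZ -scalerAl.
  pose Lm := GRing.isLinear.Build K A A _ _ lin.
  pose L : {linear A -> A} := HB.pack (fun f : A => wmon K x * f * wmon K y) Lm.
  apply: (@supp_linext _ L _ _ q _ qs) => m sm; rewrite /= !wmonM -catA.
  by apply: supp_in_wmon; rewrite wE; apply: below_cat.
have [m /below_q' mw|r Ir rn] := @combine_reductions
    (fun m => normal m /\ ((m : seq nat) = w \/ below w m)) q'.
  have [r Ir rn] := IHw _ mw; exists r => // m' /rn[nm' m'm]; split=> //.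
  by right; case: m'm => [-> //|/(below_trans mw)].
exists (- r); last exact: supp_inN.
have -> : wmon K w - - r = (wmon K w + q') - (q' - r).
  by rewrite opprB addrA addrAC addrK opprK.
exact: (idealB idealI Iq' Ir).
Qed.
End NormalForm.

(** * The ideal of gamma_3 and its Groebner basis *)

Lemma bracket_swap (R : nzRingType) (f g h : R) :
  [< f, [< g, h >] >] = [< [< h, g >], f >].
Proof. by rewrite /bracket -(opprB (h * g)) mulrN mulNr opprK addrC. Qed.

Lemma rmorph_bracket2 (R S : nzRingType) (phi : {rmorphism R -> S}) f g h :
  phi [< [< f, g >], h >] = [< [< phi f, phi g >], phi h >].
Proof. by rewrite /bracket !(rmorphB, rmorphM). Qed.

Lemma add_eq_sub_sub (V : zmodType) (a b c : V) : b + c = a - ((a - b) - c).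
Proof. by rewrite opprB opprB addrCA [a + _]addrC subrK addrC. Qed.

Section Gamma3.
Variable K : fieldType.
Local Notation A := {freeAlg K}.
Local Notation x := (letter K).

Lemma free_lie_letter i : free_lie (x i).
Proof. by move=> U _ sub; apply: sub; exists i. Qed.

Lemma free_lie_bracket (f g : A) :
  free_lie f -> free_lie g -> free_lie [< f, g >].
Proof.
by move=> Lf Lg U LU sub; apply: (proj2 LU); [apply: Lf|apply: Lg].
Qed.

Lemma lie_prod_bracket (U V : A -> Prop) f g :
  U f -> V g -> lie_prod U V [< f, g >].
Proof. by move=> Uf Vg W _ sub; apply: sub; exists f, g. Qed.

Lemma gamma3_bracket (f g h : A) :
  free_lie f -> free_lie g -> free_lie h -> gamma3 [< [< f, g >], h >].
Proof.
move=> Lf Lg Lh; apply: (lie_prod_bracket _ Lh).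
exact: (lie_prod_bracket Lf Lg).
Qed.

Local Notation I := (ideal_gen (@gamma3 K)).

(** The preimage of the ideal under phi is an ideal containing the brackets of
    letters [[x_i, x_j], x_k], since phi sends letters to letters. *)
Lemma gamma3_ideal_stable (phi : {lrmorphism A -> A}) (f : A) :
  monotone_endo phi -> I f -> I (phi f).
Proof.
move=> [phiX _] If; have II := ideal_gen_ideal (@gamma3 K).
have phiI : two_sided_ideal (fun g => I (phi g)).
  split.
  - by rewrite rmorph0; apply: (ideal0 II).
  - move=> g h Ig Ih; rewrite rmorphD; exact: (idealD II Ig Ih).
  - move=> g h Ih; rewrite rmorphM; exact: (idealMl II _ Ih).
  - move=> g h Ig; rewrite rmorphM; exact: (idealMr II _ Ig).
apply: (If _ phiI); apply: (gamma3_in_ideal phiI) => i j k.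
have [[i' Ei] [j' Ej] [k' Ek]] := And3 (phiX i) (phiX j) (phiX k).
have E := etrans (rmorph_bracket2 phi (x i) (x j) (x k))
  (congr2 (@bracket A) (congr2 (@bracket A) Ei Ej) Ek).
rewrite E; apply: ideal_gen_sub.
by apply: gamma3_bracket; apply: free_lie_letter.
Qed.

Lemma generators_in_ideal g : g \in generators K -> I g.
Proof.
have L := free_lie_letter; have B := free_lie_bracket.
rewrite /generators 5!in_cons => gG; apply: ideal_gen_sub.
case/predU1P: gG => [->|]; first exact: (gamma3_bracket (L _) (L _) (L _)).
case/predU1P => [->|].
  by rewrite bracket_swap; exact: (gamma3_bracket (L _) (L _) (L _)).
case/predU1P => [->|].
  by rewrite bracket_swap; exact: (gamma3_bracket (L _) (L _) (L _)).
case/predU1P => [->|]; first exact: (gamma3_bracket (L _) (L _) (L _)).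
case/predU1P => [->|//].
exact: (gamma3_bracket (L _) (L _) (B _ _ (L _) (L _))).
Qed.

End Gamma3.

Theorem theorem3p3 (K : fieldType) :
  let x1 := letter K 0 in
  let x2 := letter K 1 in
  let x3 := letter K 2 in
  groebner_S_basis (monotone_endos K) (ideal_gen (@gamma3 K))
    (fun g => g \in [:: [< [< x2, x1 >], x1 >];
                        [< x2, [< x2, x1 >] >];
                        [< x3, [< x2, x1 >] >];
                        [< [< x3, x1 >], x2 >];
                        [< [< x3, x2 >], [< x3, x1 >] >] ]).
Proof.
move=> x1 x2 x3; have II := ideal_gen_ideal (@gamma3 K).
have stable := @gamma3_ideal_stable K.
have obs (h : nat -> nat) s :
    {homo h : a b / (a < b)%N} -> s \in obstructions ->
    exists2 g, S_image (monotone_endos K) (fun g => g \in generators K) g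
      & led_by (map h s) g.
  move=> hh sO; have [g gG gs] := obstruction_led K sO.
  exists (relabel h g); last exact: led_by_relabel.
  by exists (relabel_lr K h), g; split=> //; apply: relabel_monotone.
have image_I g : S_image (monotone_endos K) (fun g => g \in generators K) g ->
    ideal_gen (@gamma3 K) g.
  move=> [phi [g' [phiS g'G ->]]]; apply: stable phiS _.
  exact: generators_in_ideal g'G.
split.
- by split=> // phi phiS f; apply: stable.
- exact: generators_in_ideal.
split; first exact: image_I.
move=> f If f0.
have [nf|[h [s hh /andP[sO sf]]]] := normal_or_obstructed (lead_word f);
  last first.
  have [g gS gs] := obs h s hh sO; have [g0 gl] := led_by_lead gs.
  by exists g; split=> //; rewrite gl.
set w := lead_word f in nf *; exfalso.
have wf : w \in msupp f := lead_word_msupp f0.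
set c := f@_w; have c0 : c != 0 by rewrite mcoeff_neq0.
pose smaller (m : word) := normal m /\ (deglex m w /\ m != w).
have obsI (h : nat -> nat) s :
    {homo h : a b / (a < b)%N} -> s \in obstructions ->
    exists2 g, ideal_gen (@gamma3 K) g & led_by (map h s) g.
  by move=> hh sO; have [g /image_I Ig gs] := obs h s hh sO; exists g.
have mon_coeff m : (wmon K w)@_m = (w == m)%:R.
  by rewrite wmonE word_eta mcoeffU1.
(* Only the tail is reduced, so that w keeps its coefficient. *)
have [m mq|r Ir rs] := @combine_reductions K _ II smaller (f - c *: wmon K w).
  have mw : m != w.
    apply: contraTneq mq => ->.
    by rewrite -mcoeff_eq0 mcoeffB mcoeffZ mon_coeff eqxx mulr1 subrr.
  have mf : m \in msupp f.
    move: mq; rewrite -!mcoeff_neq0 mcoeffB mcoeffZ mon_coeff [w == m]eq_sym.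
    rewrite (negbTE mw).
    by rewrite mulr0 subr0.
  have lemw := lead_word_greatest mf.
  have [r Ir rm] := normal_form II obsI m; exists r => // m' /rm[nm' m'm].
  split=> //; case: m'm => [/val_inj -> //|/below_deglex/andP[le_m' m'm]].
  split; first exact: le_trans le_m' lemw.
  apply: contraNneq m'm => e; rewrite e in le_m' *.
  by apply/eqP/deglex_anti; rewrite le_m' lemw.
have If' : ideal_gen (@gamma3 K) (c *: wmon K w + r).
  have -> : c *: wmon K w + r = f - ((f - c *: wmon K w) - r).
    exact: add_eq_sub_sub.
  exact: (idealB II If Ir).
have f'0 : c *: wmon K w + r = 0.
  apply: PBW.normal_combination_eq0 If' _ => m.
  move/(fsubsetP (msuppD_le _ _)); rewrite inE.
  case/orP=> [/(fsubsetP (msuppZ_le _ _))|].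
    by rewrite wmonE word_eta msuppU1 inE => /eqP ->.
  by case/rs.
have rw : r@_w = 0.
  by apply: mcoeff_outdom; apply/negP => /rs[_ [_]]; rewrite eqxx.
move/(congr1 (mcoeff w)): f'0.
rewrite mcoeffD mcoeffZ mon_coeff eqxx mulr1 rw addr0 mcoeff0 => /eqP.
by rewrite (negbTE c0).
Qed.
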